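(* Let $h\ge 1$, let $n_1,\ldots,n_h$ be positive integers, and let the deck $D$ be a permutation of the multiset $\{1^{n_1},2^{n_2},\ldots,h^{n_h}\}$. For each label $c\in\{1,\ldots,h\}$, let $m_1,\ldots,m_\gamma$ (depending on $c$) be the lengths of the maximal blocks of consecutive cards labeled $c$ in $D$, so that $n_c=m_1+\cdots+m_\gamma$, and define $$p_c(x)=\frac{n_c!}{m_1!\,m_2!\cdots m_\gamma!}\,\eta_{m_1}(x)\,\eta_{m_2}(x)\cdots\eta_{m_\gamma}(x).$$ Then the descent polynomial of the shuffles from $D$ to the sorted deck $1^{n_1},2^{n_2},\ldots,h^{n_h}$ is $$x^{\mathrm{des}(D)}\,p_1(x)\,p_2(x)\cdots p_h(x).$$
   Context: A deck of $N$ cards is a finite sequence of $N$ labels, listed from top to bottom; labels may repeat. The notation $c^m$ means $m$ consecutive cards labeled $c$. A shuffle of $N$ cards is a permutation $\pi\in S_N$; it is a shuffle from the deck $c_1,\ldots,c_N$ to the deck $c_{\pi^{-1}(1)},\ldots,c_{\pi^{-1}(N)}$ (i.e. the card in position $i$ is sent to position $\pi(i)$). The number of descents $\mathrm{des}(\pi)$ of $\pi\in S_N$ is the number of positions $1\le i<N$ with $\pi(i)>\pi(i+1)$. The descent polynomial of the shuffles from a deck $D_1$ to a deck $D_2$ is $\sum_{\pi} x^{\mathrm{des}(\pi)}$, the sum being over all shuffles $\pi$ from $D_1$ to $D_2$. For a deck $D$ with numerical labels, $\mathrm{des}(D)$ is the number of places where a card with a greater label immediately precedes a card with a lesser label in $D$.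 For $m\ge1$, $\eta_m(x)=\sum_{d=0}^{m-1}\left\langle {m \atop d}\right\rangle x^d$, where the Eulerian number $\left\langle {m \atop d}\right\rangle$ is the number of permutations in $S_m$ with exactly $d$ descents. *)

(* Defs.v *)
From mathcomp Require Import all_boot all_order all_fingroup all_algebra.

Set Implicit Arguments.
Unset Strict Implicit.
Unset Printing Implicit Defensive.

Import GRing.Theory.
Local Open Scope ring_scope.

(* Decks are sequences of labels, top card first. Positions are numbered from
   0, so that a shuffle of N cards is an element of 'S_N. *)

(* The deck obtained from D by pi: position i receives the card which was at
   position pi^-1(i). *)
Definition shuffled (T : eqType) (D : seq T) (pi : 'S_(size D)) : seq T :=
  [seq tnth (in_tuple D) ((pi^-1)%g i) | i <- enum 'I_(size D)].

Definition is_shuffle (T : eqType) (D1 D2 : seq T) (pi : 'S_(size D1)) : bool :=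
  shuffled pi == D2.

Definition des (s : seq nat) : nat :=
  #|[set i : 'I_(size s).-1 | (nth 0 s i.+1 < nth 0 s i)%N]|.

(* Descents of pi are those of its one-line notation pi(0), ..., pi(N-1). *)
Definition perm_des (N : nat) (pi : 'S_N) : nat :=
  des [seq val (pi i) | i <- enum 'I_N].

Definition descent_poly (T : eqType) (D1 D2 : seq T) : {poly rat} :=
  \sum_(pi : 'S_(size D1) | is_shuffle D2 pi) 'X^(perm_des pi).

Definition eulerian (m d : nat) : nat :=
  #|[set s : 'S_m | perm_des s == d]|.

Definition eta (m : nat) : {poly rat} :=
  \sum_(0 <= d < m) (eulerian m d)%:R *: 'X^d.

(* The decomposition of s into maximal blocks of equal consecutive labels,
   as a sequence of pairs (label, length); see runsP. *)
Fixpoint runs (T : eqType) (s : seq T) : seq (T * nat) :=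
  if s is x :: s' then
    match runs s' with
    | (y, m) :: r => if x == y then (y, m.+1) :: r else (x, 1%N) :: (y, m) :: r
    | [::] => [:: (x, 1%N)]
    end
  else [::].

Lemma runsP (T : eqType) (s : seq T) :
  [/\ flatten [seq nseq b.2 b.1 | b <- runs s] = s,
      all (fun b => 0 < b.2)%N (runs s)
    & sorted (fun b1 b2 => b1.1 != b2.1) (runs s)].
Proof.
elim: s => [//|x s []] /=; case: (runs s) => [|[y m] r] /=.
  by move=> <-.
move=> <- /andP[m_gt0 r_gt0] srt; case: eqVneq => [->|neq_xy] /=.
  by rewrite r_gt0; split=> //; case: (r) srt.
by rewrite m_gt0 r_gt0 neq_xy.
Qed.

Definition block_lengths (T : eqType) (D : seq T) (c : T) : seq nat :=
  [seq b.2 | b <- runs D & b.1 == c].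

Lemma sumn_block_lengths (T : eqType) (D : seq T) (c : T) :
  sumn (block_lengths D c) = count_mem c D.
Proof.
have [+ _ _] := runsP D => {2}<-; rewrite /block_lengths.
elim: (runs D) => [//|[y m] r IHr] /=.
by rewrite count_cat count_nseq -IHr /=; case: eqP => _; rewrite ?mul1n ?mul0n.
Qed.

(* The polynomial p_c of the deck D, where nc is the number of cards labelled
   c; the multinomial coefficient is a quotient in rat. *)
Definition label_poly (nc : nat) (D : seq nat) (c : nat) : {poly rat} :=
  (nc`!%:R / \prod_(m <- block_lengths D c) m`!%:R) *:
    \prod_(m <- block_lengths D c) eta m.

Definition sorted_deck (h : nat) (n : nat -> nat) : seq nat :=
  flatten [seq nseq (n c) c | c <- iota 1 h].

(* Main.v *)
Require Import Defs.
From mathcomp Require Import all_boot all_order all_fingroup all_algebra.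

(* Read a shuffle from D to the sorted deck D2 as its one-line word w, a
   permutation of 0, ..., N-1 whose letters are labelled by D2 and spell D.
   Since D2 is sorted, the letters with a smaller label are smaller, so across
   the boundary of two blocks of D the word w descends exactly when D does.
   Removing the first block c^m of D removes an arbitrary arrangement of m of
   the letters labelled c, which contributes a factor 'C(k, m) eta_m if k such
   letters are left; the binomials of a label c telescope to the multinomial
   coefficient of p_c. *)

Set Implicit Arguments.
Unset Strict Implicit.
Unset Printing Implicit Defensive.

Import GRing.Theory.
Local Open Scope ring_scope.

(** * Descents of words *)

Lemma des_sum (s : seq nat) :
  des s = (\sum_(i < (size s).-1) (nth 0 s i.+1 < nth 0 s i))%N.
Proof.
rewrite /des -sum1_card big_mkcond /=; apply: eq_bigr => i _.
by rewrite inE; case: ltnP.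
Qed.

Lemma des_nil : des [::] = 0%N.
Proof. by rewrite des_sum big1 // => -[]. Qed.

Lemma des_cons (x : nat) (s : seq nat) :
  des (x :: s) = ((if s is y :: _ then (y < x)%N else 0) + des s)%N.
Proof.
case: s => [|y s]; first by rewrite !des_sum !big1 // => -[].
by rewrite !des_sum /= big_ord_recl.
Qed.

Lemma des_cat (u v : seq nat) :
  des (u ++ v) =
    (des u + (if v is y :: _ then (y < last 0 u)%N else 0) + des v)%N.
Proof.
elim: u => [|x u IHu]; first by rewrite /= des_nil; case: v.
rewrite cat_cons !des_cons IHu; case: u {IHu} => [|z u] /=; last first.
  by rewrite !addnA.
by rewrite des_nil; case: v.
Qed.

Lemma des_nseq (m c : nat) : des (nseq m c) = 0%N.
Proof.
elim: m => [|m IHm] /=; first exact: des_nil.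
by rewrite des_cons IHm; case: m {IHm} => //= m; rewrite ltnn.
Qed.

Lemma des_map (g : nat -> nat) (w : seq nat) :
  {in w &, {mono g : x y / (x < y)%N}} -> des (map g w) = des w.
Proof.
elim: w => [|x w IHw] g_mono //=; rewrite !des_cons IHw; last first.
  by move=> y z wy wz; apply: g_mono; rewrite inE (wy, wz) orbT.
by case: w g_mono {IHw} => //= y w ->; rewrite // !inE eqxx ?orbT.
Qed.

Lemma des_ltn_size (s : seq nat) : (0 < size s)%N -> (des s < size s)%N.
Proof.
move=> s_gt0; apply: (@leq_ltn_trans (size s).-1); last by rewrite prednK.
by rewrite -[leqRHS]card_ord max_card.
Qed.

(** * Words with distinct letters that spell a given deck *)

Fixpoint arrangements (f : nat -> nat) (S D : seq nat) : seq (seq nat) :=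
  if D is d :: D' then
    [seq x :: w | x <- [seq x <- S | f x == d],
                  w <- arrangements f [seq y <- S | y != x] D']
  else [:: [::]].

Lemma big_arrangements_cons (R : Type) (idx : R) (op : Monoid.law idx)
    f S d D (F : seq nat -> R) :
  \big[op/idx]_(w <- arrangements f S (d :: D)) F w =
    \big[op/idx]_(x <- S | f x == d)
      \big[op/idx]_(w <- arrangements f [seq y <- S | y != x] D) F (x :: w).
Proof. by rewrite /= big_allpairs_dep big_filter. Qed.

Lemma mem_arrangements f S D w :
  (w \in arrangements f S D) =
    [&& uniq w, all (mem S) w & map f w == D].
Proof.
elim: D S w => [|d D IHD] S [|x w] //=.
- by rewrite (_ : (_ :: _ == [::]) = false) ?andbF.
- by apply/negP => /allpairsPdep[? [? [_ _]]].
rewrite eqseq_cons; apply/allpairsPdep/idP.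
  case=> y [v [+ + [-> ->]]]; rewrite IHD mem_filter => /andP[-> ->].
  case/and3P=> -> /allP vS ->; rewrite !andbT /=; apply/andP; split.
    by apply/negP => /vS; rewrite inE mem_filter eqxx.
  by apply/allP => z /vS; rewrite !inE mem_filter => /andP[].
case/and3P=> /andP[xw uw] /andP[xS /allP wS] /andP[fx fw].
exists x, w; rewrite mem_filter fx IHD uw fw andbT; split => //.
apply/allP => z wz; have zS : z \in S by apply: wS.
rewrite inE mem_filter zS andbT.
by apply: contraNneq xw => <-.
Qed.

Lemma arrangements_uniq f S D : uniq S -> uniq (arrangements f S D).
Proof.
elim: D S => [|d D IHD] S //= uS; apply: allpairs_uniq_dep.
- exact: filter_uniq.
- by move=> x _; apply/IHD/filter_uniq.
- by move=> [x1 w1] [x2 w2] _ _ [-> ->].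
Qed.

Lemma big_arrangements_cat (R : nmodType) f S D1 D2 (F : seq nat -> R) :
  \sum_(w <- arrangements f S (D1 ++ D2)) F w =
    \sum_(u <- arrangements f S D1)
      \sum_(v <- arrangements f [seq y <- S | y \notin u] D2) F (u ++ v).
Proof.
elim: D1 S F => [|d D1 IHD] S F.
  rewrite big_seq1 /=; congr (\sum_(w <- arrangements _ _ _) _).
  by rewrite -[LHS]filter_predT; apply: eq_filter.
rewrite cat_cons !big_arrangements_cons; apply: eq_bigr => x _.
rewrite IHD; apply: eq_bigr => u _; rewrite -filter_predI.
congr (\sum_(w <- arrangements _ _ _) _).
by apply: eq_filter => y; rewrite /= inE negb_or andbC.
Qed.

(** Turning a smaller alphabet into a condition on words allows the sums over [t] and [w] to be
    exchanged in the double counting below. *)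
Lemma big_arrangements_filter (R : nmodType) f S D t (F : seq nat -> R) :
  \sum_(w <- arrangements f [seq y <- S | y != t] D) F w =
    \sum_(w <- arrangements f S D | t \notin w) F w.
Proof.
elim: D S F => [|d D IHD] S F; first by rewrite [RHS]big_mkcond !big_seq1.
rewrite [RHS]big_mkcond !big_arrangements_cons big_filter_cond.
rewrite big_mkcond [RHS]big_mkcond; apply: eq_bigr => x _.
case: (f x == d); last by rewrite andbF.
have [->|xt] := eqVneq x t => /=; first by rewrite big1 // => w _; rewrite inE eqxx.
have -> : [seq y <- [seq y <- S | y != t] | y != x] =
          [seq y <- [seq y <- S | y != x] | y != t].
  by rewrite -!filter_predI; apply: eq_filter => y; rewrite /= andbC.
rewrite IHD [LHS]big_mkcond; apply: eq_bigr => w _.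
by rewrite inE eq_sym (negPf xt).
Qed.

Lemma arrangements_map f g S D : {in S &, injective g} ->
  arrangements f (map g S) D = map (map g) (arrangements (f \o g) S D).
Proof.
elim: D S => [|d D IHD] S g_inj //=.
rewrite filter_map map_flatten -!map_comp; congr flatten.
apply/eq_in_map => x; rewrite mem_filter => /andP[_ xS] /=.
rewrite -map_comp filter_map.
have -> : [seq y <- S | preim g (fun y => y != g x) y] = [seq y <- S | y != x].
  by apply: eq_in_filter => y yS /=; rewrite (inj_in_eq g_inj).
rewrite IHD => [|y z]; last first.
  by rewrite !mem_filter => /andP[_ yS] /andP[_ zS]; apply: g_inj.
by rewrite -!map_comp.
Qed.

(** A word without repetition that is as long as its alphabet uses every letter. *)
Lemma perm_arrangements f S D : uniq S -> size D = size S ->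
  perm_eq (arrangements f S D) [seq w <- permutations S | map f w == D].
Proof.
move=> uS szD; apply: uniq_perm => [||w].
- exact: arrangements_uniq.
- exact/filter_uniq/permutations_uniq.
rewrite mem_arrangements mem_filter mem_permutations [RHS]andbC andbA.
have [fw|] := eqVneq (map f w) D; last by rewrite !andbF.
rewrite !andbT.
have szw : size w = size S by rewrite -szD -fw size_map.
apply/idP/idP => [/andP[uw /allP wS]|pw]; last first.
  by rewrite (perm_uniq pw) uS; apply/allP => x; rewrite inE (perm_mem pw).
apply: uniq_perm => //; have := uniq_min_size uw wS.
by rewrite szw leqnn => /(_ isT)[].
Qed.

(** * One-line words of permutations and Eulerian polynomials *)

Definition one_line (N : nat) (pi : 'S_N) : seq nat :=
  [seq val (pi i) | i <- enum 'I_N].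

Lemma perm_one_line (N : nat) :
  perm_eq [seq one_line pi | pi <- index_enum 'S_N] (permutations (iota 0 N)).
Proof.
have inj : injective (@one_line N).
  move=> p q /eq_in_map pq.
  by apply/permP => i; apply/val_inj/pq; rewrite mem_enum.
have u : uniq [seq one_line pi | pi <- index_enum 'S_N].
  by rewrite map_inj_uniq // index_enum_uniq.
apply: uniq_perm => //; first exact: permutations_uniq.
(* By injectivity of [one_line], inclusion and a comparison of sizes suffice; both lists have [N!]
   entries. *)
apply: (uniq_min_size u _ _).2.
  move=> w /mapP[pi _ ->]; rewrite mem_permutations -val_enum_ord /one_line.
  rewrite (map_comp val pi) perm_map //; apply: uniq_perm.
  - by rewrite map_inj_uniq ?enum_uniq //; apply: perm_inj.
  - exact: enum_uniq.
  by move=> i; rewrite mem_enum -[i](permKV pi) mem_map ?mem_enum //; apply: perm_inj.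
rewrite size_permutations ?iota_uniq // size_map size_iota.
by rewrite -card_Sn -sum1_size sum1_card.
Qed.

Lemma sum_perm_arrangements (R : nmodType) f N D (F : seq nat -> R) :
  size D = N ->
  \sum_(pi : 'S_N | map f (one_line pi) == D) F (one_line pi) =
    \sum_(w <- arrangements f (iota 0 N) D) F w.
Proof.
move=> szD; rewrite (perm_big _ (perm_arrangements f (iota_uniq 0 N) _)) ?size_iota //=.
by rewrite big_filter -(perm_big _ (perm_one_line N)) big_map.
Qed.

(** Constant labels impose no condition, so all of ['S_m] is summed and then grouped by descents.
    Positivity of [m] puts [perm_des s] in the range [d < m] of [eta]; for [m = 0] the sides would
    be 0 and 1. *)
Lemma eta_sum (m : nat) : (0 < m)%N ->
  eta m = \sum_(w <- arrangements (fun=> 0%N) (iota 0 m) (nseq m 0%N)) 'X^(des w).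
Proof.
move=> m_gt0; rewrite -sum_perm_arrangements ?size_nseq //.
under [RHS]eq_bigl => s.
  rewrite /one_line -map_comp (_ : _ == _ = true); last first.
    by apply/eqP; rewrite -[m in RHS]card_ord cardE; elim: (enum _) => //= i e ->.
  over.
have ltm (s : 'S_m) : (perm_des s < m)%N.
  have := @des_ltn_size (one_line s).
  by rewrite size_map size_enum_ord; apply.
rewrite (partition_big (fun s => Ordinal (ltm s)) predT) //= /eta big_mkord.
apply: eq_bigr => d _; rewrite /eulerian -sum1_card natr_sum scaler_suml.
apply: eq_big => [s|s]; first by rewrite inE.
by rewrite inE scale1r => /eqP <-.
Qed.

(** * Arrangements of a single block *)

Lemma perm_filter_mem (T : eqType) (S u : seq T) :
  uniq S -> uniq u -> {subset u <= S} -> perm_eq [seq y <- S | y \in u] u.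
Proof.
move=> uS uu sub; apply: uniq_perm => //; first exact: filter_uniq.
by move=> y; rewrite mem_filter andb_idr //; apply: sub.
Qed.

(** Once the alphabet is restricted to the letters labelled [c], labels carry no information and can
    be replaced by a constant. *)
Lemma arrangements_nseq f S c m :
  arrangements f S (nseq m c) =
    arrangements (fun=> 0%N) [seq x <- S | f x == c] (nseq m 0%N).
Proof.
elim: m S => [|m IHm] S //=; rewrite eqxx filter_predT; congr flatten.
apply: eq_map => x; rewrite IHm -!filter_predI; congr (map _ (arrangements _ _ _)).
by apply: eq_filter => y; rewrite /= andbC.
Qed.

(* Deleting one letter t of T in all possible ways counts every arrangement
   size T - m times, which yields the binomial coefficient by induction. *)
Lemma sum_des_arrangements (T : seq nat) m :
    sorted ltn T -> (0 < m <= size T)%N ->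
  \sum_(w <- arrangements (fun=> 0%N) T (nseq m 0%N)) 'X^(des w) =
    'C(size T, m)%:R *: eta m.
Proof.
move sz_T: (size T) => N; elim: N T sz_T => [|N IHN] T sz_T sT.
  by case: m.
case/andP=> m_gt0; have uT : uniq T := sorted_uniq ltn_trans ltnn sT.
rewrite leq_eqVlt => /predU1P[->|lt_mN].
  (* If [m = N.+1], every letter is used: the increasing bijection [nth 0 T] from [0, ..., N] onto
     [T] preserves descents, and the binomial is 1. *)
  have nth_mono : {in iota 0 N.+1 &, {mono nth 0%N T : x y / (x < y)%N}}.
    move=> x y; rewrite !mem_iota !add0n /= => xN yN.
    have nth_homo := sorted_ltn_nth ltn_trans 0%N sT.
    case: (ltngtP x y) => [lt_xy|lt_yx|->]; last exact: ltnn.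
      by apply: nth_homo; rewrite ?inE ?sz_T.
    by apply/negbTE; rewrite -leqNgt ltnW // nth_homo ?inE ?sz_T.
  have nth_inj : {in iota 0 N.+1 &, injective (nth 0%N T)}.
    move=> x y; rewrite !mem_iota !add0n /= => xN yN /eqP.
    by rewrite nth_uniq ?sz_T // => /eqP.
  have defT : T = map (nth 0%N T) (iota 0 N.+1) by rewrite -sz_T -/(mkseq _ _) mkseq_nth.
  rewrite [in LHS]defT arrangements_map // big_map binn scale1r eta_sum //.
  rewrite big_seq [RHS]big_seq; apply: eq_bigr => w.
  rewrite mem_arrangements => /and3P[_ /allP wS _]; congr ('X^_).
  by apply: des_map => x y /wS xS /wS yS; apply: nth_mono.
have card_out w : w \in arrangements (fun=> 0%N) T (nseq m 0%N) ->
    count (fun t => t \notin w) T = (N.+1 - m)%N.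
  rewrite mem_arrangements => /and3P[uw /allP wT /eqP /(congr1 size)].
  rewrite size_map size_nseq => <-; rewrite -sz_T -(count_predC (mem w) T).
  by rewrite -(size_filter (mem w)) (perm_size (perm_filter_mem uT uw wT)) addKn.
have nz : (N.+1 - m)%:R != 0 :> rat by rewrite Num.Theory.pnatr_eq0 -lt0n subn_gt0.
(* Both sides are multiplied by [N.+1 - m], and [(N.+1 - m) * 'C(N.+1, m) = N.+1 * 'C(N, m)] brings
   in the binomial of the induction hypothesis. *)
apply: (scalerI nz); rewrite scalerA -natrM -mul_bin_down natrM -scalerA.
transitivity (\sum_(t <- T) \sum_(w <- arrangements (fun=> 0%N)
                [seq y <- T | y != t] (nseq m 0%N)) 'X^(des w) : {poly rat}).
  under [RHS]eq_bigr do rewrite big_arrangements_filter.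
  rewrite (exchange_big_dep predT) //= scaler_sumr big_seq [RHS]big_seq.
  by apply: eq_bigr => w /card_out <-; rewrite big_const_seq iter_addr_0 scaler_nat.
rewrite big_seq (eq_bigr (fun=> 'C(N, m)%:R *: eta m)) => [|t tT].
  by rewrite -big_seq big_const_seq iter_addr_0 count_predT sz_T !scaler_nat.
apply: IHN.
- by apply/succn_inj; rewrite size_filter -sz_T -(count_predC (pred1 t) T)
                              count_uniq_mem // tT.
- exact: sorted_filter ltn_trans _ _ sT.
- by rewrite m_gt0.
Qed.

(** * Decks as lists of maximal blocks *)

Notation deck_of r := (flatten [seq nseq b.2 b.1 | b <- r]).

(** This uniqueness of the block decomposition permits induction on the list of blocks instead of
    the deck. *)
Lemma runs_deck_of (T : eqType) (r : seq (T * nat)) :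
    all (fun b => 0 < b.2)%N r -> sorted (fun b1 b2 => b1.1 != b2.1) r ->
  runs (deck_of r) = r.
Proof.
elim: r => [|[c m] r IHr] //= /andP[m_gt0 r_gt0] c_r.
have {}IHr := IHr r_gt0 (path_sorted c_r).
have {}c_r : if r is b :: _ then c != b.1 else true by case: (r) c_r => //= ? ? /andP[].
(* Further cards labelled [c] only lengthen the first block; the base case, a single card, uses that
   the next label differs. *)
case: m m_gt0 => // m _; elim: m => [|m IHm] /=; last first.
  by move: IHm => /= ->; rewrite eqxx.
rewrite IHr; by case: r c_r {IHr r_gt0} => [|[d k] r] //= /negPf ->.
Qed.

Lemma label_poly_cons_neq k (r : seq (nat * nat)) b d :
    all (fun b => 0 < b.2)%N (b :: r) ->
    sorted (fun b1 b2 => b1.1 != b2.1) (b :: r) -> b.1 != d ->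
  label_poly k (deck_of (b :: r)) d = label_poly k (deck_of r) d.
Proof.
move=> r_gt0 r_sorted bd; rewrite /label_poly /block_lengths !runs_deck_of //=.
- by rewrite (negPf bd).
- by case/andP: r_gt0.
- exact: path_sorted r_sorted.
Qed.

(** In use, [k] is the number of cards labelled [b.1] after the first block. The new factor comes
    from [(b.2 + k)! = 'C(b.2 + k, b.2) * b.2! * k!]. *)
Lemma label_poly_cons_eq k (r : seq (nat * nat)) b :
    all (fun b => 0 < b.2)%N (b :: r) ->
    sorted (fun b1 b2 => b1.1 != b2.1) (b :: r) ->
  label_poly (b.2 + k) (deck_of (b :: r)) b.1 =
    'C(b.2 + k, b.2)%:R *: eta b.2 * label_poly k (deck_of r) b.1.
Proof.
move=> r_gt0 r_sorted; rewrite /label_poly /block_lengths !runs_deck_of //=.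
- rewrite eqxx /= !big_cons -scalerAl -scalerAr scalerA; congr (_ *: _).
  rewrite -(bin_fact (leq_addr k b.2)) addKn !natrM invfM.
  have nz : (b.2)`!%:R != 0 :> rat by rewrite Num.Theory.pnatr_eq0 -lt0n fact_gt0.
  by rewrite !mulrA; congr (_ * _); rewrite -!mulrA [_ * (_ / _)]mulrCA mulfV // mulr1.
- by case/andP: r_gt0.
- exact: path_sorted r_sorted.
Qed.

(** The last letter of [u] is labelled [c]. By maximality of the block, the first letter of [v] has
    a different label, so [f_mono] decides how the two letters compare. *)
Lemma des_arrangement_cat f S u v c m D :
    {in S &, forall x y, f x < f y -> x < y}%N -> (0 < m)%N ->
    ohead D != Some c ->
    u \in arrangements f S (nseq m c) -> v \in arrangements f S D ->
  des (u ++ v) =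
    (des u + (if D is d :: _ then (d < c)%N else 0) + des v)%N.
Proof.
move=> f_mono m_gt0 cD; rewrite !mem_arrangements.
case/and3P=> _ /allP uS /eqP fu /and3P[_ /allP vS /eqP fv].
rewrite des_cat -fv; congr (_ + _ + _)%N; case: v fv vS => [|y v] //= fv vS.
rewrite -fv /= (inj_eq Some_inj) in cD.
have yS : y \in S by apply: vS; rewrite inE eqxx.
have u_last : last 0%N u \in u.
  case: u fu {uS} => [|x u] fu /=; last exact: mem_last.
  by rewrite -(size_nseq m c) -fu in m_gt0.
have f_last : f (last 0%N u) = c.
  by have := map_f f u_last; rewrite fu mem_nseq => /andP[_ /eqP].
have := uS _ u_last; move: (last 0%N u) f_last => x fx xS; congr nat_of_bool.
rewrite -fx in cD *; case: (ltngtP (f y) (f x)) cD => // lt _.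
  exact: f_mono.
by apply/negbTE; rewrite -leqNgt ltnW // f_mono.
Qed.

(** [S] is any increasing alphabet, so that induction can pass to the letters left over. [L] stays
    fixed: a label already exhausted contributes the factor 1. *)
Lemma sum_arrangements_blocks f (S L : seq nat) (r : seq (nat * nat)) :
    sorted ltn S -> {in S &, forall x y, f x < f y -> x < y}%N ->
    all (fun b => 0 < b.2)%N r -> sorted (fun b1 b2 => b1.1 != b2.1) r ->
    uniq L -> {subset deck_of r <= L} -> perm_eq (deck_of r) (map f S) ->
  \sum_(w <- arrangements f S (deck_of r)) 'X^(des w) =
    'X^(des (deck_of r)) *
      \prod_(c <- L) label_poly (count_mem c (deck_of r)) (deck_of r) c.
Proof.
move=> + + + + uL; elim: r S => [|b r IHr] S sS f_mono r_gt0 r_sorted rL rS.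
  rewrite big_seq1 big1 ?mulr1 // => c _.
  by rewrite /label_poly /block_lengths /= !big_nil divr1 scale1r.
have uS : uniq S := sorted_uniq ltn_trans ltnn sS.
have [m_gt0 r'_gt0] := andP r_gt0.
case: b => c m in r_gt0 r_sorted rL rS m_gt0 *.
set D := deck_of r in IHr *.
have eqD : deck_of ((c, m) :: r) = nseq m c ++ D by [].
have cD : ohead D != Some c.
  rewrite /D; case: (r) r_sorted r'_gt0 => [|[d [|k]] r'] //= /andP[cd _] _.
  by rewrite (inj_eq Some_inj) eq_sym.
have countD : count (fun x => f x == c) S = (m + count_mem c D)%N.
  rewrite -[LHS](count_map f (pred1 c)) -(seq.permP rS) eqD count_cat count_nseq /=.
  by rewrite eqxx mul1n.
have cL : c \in L by apply: rL; rewrite eqD mem_cat mem_nseq m_gt0 eqxx.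
set b := (if D is d :: _ then (d < c)%N : nat else 0%N).
(* By induction, the sum over the remaining words does not depend on which letters [u] has used, so
   it factors out. *)
transitivity (\sum_(u <- arrangements f S (nseq m c)) 'X^(des u) *
    ('X^b * ('X^(des D) * \prod_(c <- L) label_poly (count_mem c D) D c)) : {poly rat}).
  rewrite eqD big_arrangements_cat big_seq [RHS]big_seq; apply: eq_bigr => u arr_u.
  have /and3P[uu /allP u_S /eqP fu] : [&& uniq u, all (mem S) u & map f u == nseq m c].
    by rewrite -mem_arrangements.
  have subS : {subset [seq y <- S | y \notin u] <= S}.
    by move=> y; rewrite mem_filter => /andP[].
  rewrite -(IHr [seq y <- S | y \notin u]) //.
  - rewrite !mulr_sumr big_seq [RHS]big_seq; apply: eq_bigr => v arr_v.
    rewrite (des_arrangement_cat (D := D) f_mono m_gt0 cD arr_u) ?exprD ?mulrA //.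
    move: arr_v; rewrite !mem_arrangements => /and3P[-> /allP vS ->].
    by rewrite andbT; apply/allP => y /vS /subS.
  - exact: sorted_filter ltn_trans _ _ sS.
  - by move=> x y /subS xS /subS yS; apply: f_mono.
  - exact: path_sorted r_sorted.
  - by move=> x xD; apply: rL; rewrite eqD mem_cat xD orbT.
  rewrite -(perm_cat2l (nseq m c)) -eqD (perm_trans rS) // -fu -map_cat.
  apply: perm_map; rewrite -(perm_filterC (mem u)) perm_cat2r.
  exact: perm_filter_mem.
rewrite -mulr_suml arrangements_nseq sum_des_arrangements ?size_filter ?countD;
  [| exact: sorted_filter ltn_trans _ _ sS | by rewrite m_gt0 leq_addr].
rewrite eqD des_cat des_nseq add0n -/D.
have -> : last 0%N (nseq m c) = c by case: (m) m_gt0 => // k _; elim: k.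
rewrite -/b exprD mulrCA -[RHS]mulrA; congr (_ * _); rewrite mulrCA; congr (_ * _).
rewrite (bigD1_seq c) // [RHS](bigD1_seq c) //= mulrA; congr (_ * _).
  rewrite count_cat count_nseq /= eqxx mul1n.
  exact/esym/(label_poly_cons_eq _ r_gt0 r_sorted).
apply: eq_bigr => d dc; rewrite -eqD (label_poly_cons_neq _ r_gt0 r_sorted) ?[_ == d]eq_sym //.
by rewrite eqD count_cat count_nseq /= eq_sym (negPf dc) mul0n.
Qed.

(** * Shuffles to the sorted deck *)

(** The card at position [i] of [D1] lands at position [pi i] of [D2], which removes the inverse
    from [shuffled]. Equal sizes keep [nth] within range. *)
Lemma is_shuffle_one_line D1 D2 (pi : 'S_(size D1)) : size D2 = size D1 ->
  is_shuffle D2 pi = (map (nth 0%N D2) (one_line pi) == D1).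
Proof.
move=> szD; rewrite /is_shuffle /shuffled /one_line.
have nth_o (o : 'I_(size D1)) j : nth j (enum 'I_(size D1)) (val o) = o.
  exact: nth_ord_enum.
have lt_o (o : 'I_(size D1)) : (val o < size (enum 'I_(size D1)))%N.
  by rewrite size_enum_ord; apply: ltn_ord.
have nth_pi (o : 'I_(size D1)) :
    nth 0%N [seq val (pi i) | i <- enum 'I_(size D1)] (val o) = val (pi o).
  by rewrite (nth_map o) ?nth_o.
have nth_one_line (s : seq nat) (o : 'I_(size D1)) :
    nth 0%N (map (nth 0%N s) [seq val (pi i) | i <- enum 'I_(size D1)]) (val o) =
    nth 0%N s (val (pi o)).
  by rewrite (nth_map 0%N) ?nth_pi // size_map.
apply/eqP/eqP => [<-|defD1].
  apply: (@eq_from_nth _ 0%N) => [|i]; rewrite 2!size_map size_enum_ord // => lt_i.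
  have [o ->] : exists o : 'I_(size D1), i = val o by exists (Ordinal lt_i).
  by rewrite nth_one_line (nth_map o) // nth_o permK (tnth_nth 0%N).
apply: (@eq_from_nth _ 0%N) => [|i]; rewrite size_map size_enum_ord // => lt_i.
have [o ->] : exists o : 'I_(size D1), i = val o by exists (Ordinal lt_i).
by rewrite (nth_map o) // nth_o (tnth_nth 0%N) -[in RHS](permKV pi o) -nth_one_line defD1.
Qed.

Lemma count_sorted_deck h n c :
  (1 <= c <= h)%N -> count_mem c (sorted_deck h n) = n c.
Proof.
move=> ch; rewrite /sorted_deck count_flatten -map_comp sumnE big_map.
under eq_bigr do rewrite /= count_nseq /=.
rewrite (bigD1_seq c) ?iota_uniq ?mem_iota ?add1n //= eqxx mul1n big1 ?addn0 //.
by move=> d /negPf ->.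
Qed.

Lemma sorted_deck_sorted h n : sorted leq (sorted_deck h n).
Proof.
(* The first label is generalised to [a], since the tail of the list of labels starts at [a.+1]. *)
rewrite /sorted_deck; elim: h 1%N => [|h IHh] a //=.
rewrite sorted_pairwise; last exact: leq_trans.
rewrite pairwise_cat -!sorted_pairwise ?IHh; try exact: leq_trans.
rewrite andbT; apply/andP; split.
  apply/allrelP => x y; rewrite mem_nseq => /andP[_ /eqP ->].
  case/flatten_mapP => d; rewrite mem_iota mem_nseq => /andP[ad _] /andP[_ /eqP ->].
  exact: ltnW.
by case: (n a) => //= k; elim: k => //= k ->; rewrite leqnn.
Qed.

Theorem mainTheorem7 (h : nat) (n : nat -> nat) (D : seq nat)
    (h_ge1 : (1 <= h)%N)
    (n_gt0 : forall c : nat, (1 <= c <= h)%N -> (0 < n c)%N)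
    (D_perm : perm_eq D (sorted_deck h n)) :
  descent_poly D (sorted_deck h n) =
    'X^(des D) * \prod_(1 <= c < h.+1) label_poly (n c) D c.
Proof.
set D2 := sorted_deck h n in D_perm *; have szD := perm_size D_perm.
transitivity (\sum_(w <- arrangements (nth 0%N D2) (iota 0 (size D)) D)
                'X^(des w) : {poly rat}).
  rewrite -sum_perm_arrangements //; apply: eq_bigl => pi.
  exact/is_shuffle_one_line/esym.
have [eqD D_gt0 D_sorted] := runsP D.
rewrite szD -[in LHS]eqD (@sum_arrangements_blocks _ _ (index_iota 1 h.+1)) //.
- rewrite eqD; congr (_ * _); rewrite big_seq [RHS]big_seq; apply: eq_bigr => c.
  by rewrite mem_index_iota => ch; rewrite (seq.permP D_perm) count_sorted_deck.
- exact: iota_ltn_sorted.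
- move=> x y; rewrite !mem_iota !add0n /= => xN yN; rewrite !ltnNge.
  (* Contrapositive: in a sorted deck, an earlier position has a label at most as large. *)
  apply: contra => le_yx.
  exact: (sorted_leq_nth leq_trans leqnn 0%N (sorted_deck_sorted h n)).
- exact: iota_uniq.
- move=> c; rewrite eqD (perm_mem D_perm) => /flatten_mapP[d].
  rewrite mem_iota mem_nseq mem_index_iota => dh /andP[_ /eqP ->].
  by rewrite add1n in dh.
by rewrite eqD -/(mkseq _ _) mkseq_nth.
Qed.
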